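(* Let $\hat x_0$ be any solution obtained using Phase 1 data $D_1$, let $k=(k_j)_{j=1,\ldots,l}\in\mathbb R^l$ be a vector with positive entries, and suppose $\rho$ is an upper bound, with confidence level $1-\delta$ and generated under Phase 2 data $D_2$, of the $(1-\epsilon)$-quantile of $$\max_{j=1,\ldots,l}\frac{g_j(\hat x_0;\xi)-b_j}{k_j}.$$ Let $\hat x$ be an optimal solution of $$\text{minimize } f(x)\ \text{ subject to }\ g(x;\xi)\le b\ \ \forall\,\xi:\ g(\hat x_0;\xi)\le b+\rho k .$$ Then $\hat x$ is feasible with confidence $1-\delta$ for the chance-constrained program $$\text{minimize } f(x)\ \text{ subject to }\ P(g(x;\xi)\le b)\ge 1-\epsilon .$$ Moreover, if $\rho\le 0$, then $f(\hat x)\le f(\hat x_0)$.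
   Context: $\epsilon,\delta\in(0,1)$; $x\in\mathbb R^d$ is the decision vector, $f$ a real-valued objective, $\xi\in\mathbb R^m$ a random vector with distribution $P$, $g(x;\xi)=(g_j(x;\xi))_{j=1,\ldots,l}\in\mathbb R^l$, $b=(b_j)_{j=1,\ldots,l}\in\mathbb R^l$; vector inequalities are componentwise. The data $D$ is an i.i.d. sample from $P$, split into two disjoint (hence independent) groups, Phase 1 data $D_1$ and Phase 2 data $D_2$. The $(1-\epsilon)$-quantile of a real random variable $Y$ is $\inf\{y:P(Y\le y)\ge 1-\epsilon\}$. Let $q$ be the $(1-\epsilon)$-quantile of the displayed maximum for $\xi\sim P$ a fresh draw with $\hat x_0$ (i.e. $D_1$) held fixed. That $\rho$ is an upper bound of $q$ with confidence level $1-\delta$ generated under Phase 2 data means that, conditional on $D_1$, $\mathbb P_{D_2}(q\le\rho\,|\,D_1)\ge 1-\delta$, where $\mathbb P_{D_2}$ is probability with respect to $D_2$. ''Feasible with confidence $1-\delta$'' means that the probability, with respect to the data $D$, that $P(g(\hat x;\xi)\le b)\ge 1-\epsilon$ holds (for $\xi\sim P$ a fresh draw with the data held fixed) is at least $1-\delta$. *)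

(* Defs.v *)
(* MathComp-Analysis; R is an arbitrary realType. *)
From HB Require Import structures.
From mathcomp Require Import all_boot all_order all_algebra.
From mathcomp Require Import all_classical all_reals all_analysis.

Set Implicit Arguments.
Unset Strict Implicit.
Unset Printing Implicit Defensive.

Import Order.TTheory GRing.Theory Num.Theory.
Import numFieldNormedType.Exports.

Local Open Scope classical_set_scope.
Local Open Scope ring_scope.

(* The space R^m of the random vector xi is the type of m-tuples, because that
   is the form of R^m which carries a sigma-algebra in the library: the product
   (= Borel) one.  Decision vectors, g, b and k are row vectors. *)
Notation "'Rvec[ R ]_ m" := (m.-tuple (measurableTypeR R))
  (at level 8, m at level 2, format "''Rvec[' R ]_ m").

Definition vle (R : realType) (n : nat) (u v : 'rV[R]_n) : Prop :=
  forall j, u 0 j <= v 0 j.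

Definition quantile (R : realType) (disp : measure_display)
    (T : measurableType disp) (P : probability T R) (p : R) (Y : T -> R) : R :=
  inf [set y : R | (p%:E <= P [set t | (Y t <= y)%R])%E].

Definition mutually_independent (R : realType) (disp disp' : measure_display)
    (T : measurableType disp) (T' : measurableType disp') (I : finType)
    (Pr : probability T R) (X : I -> {mfun T >-> T'}) : Prop :=
  forall (J : {set I}) (A : I -> set T'),
    (forall i, measurable (A i)) ->
    Pr (\bigcap_(i in [set` J]) (X i @^-1` A i)) =
    (\prod_(i in J) Pr (X i @^-1` A i))%E.

Definition iid_sample (R : realType) (disp disp' : measure_display)
    (T : measurableType disp) (T' : measurableType disp') (I : finType)
    (Pr : probability T R) (P : probability T' R)
    (X : I -> {mfun T >-> T'}) : Prop :=
  mutually_independent Pr X /\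
  forall i (A : set T'), measurable A -> Pr (X i @^-1` A) = P A.

Definition phase1 (disp disp' : measure_display)
    (T : measurableType disp) (T' : measurableType disp') (n1 n2 : nat)
    (X : 'I_(n1 + n2) -> {mfun T >-> T'}) (w : T) : n1.-tuple T' :=
  [tuple X (lshift n2 i) w | i < n1].

Definition phase2 (disp disp' : measure_display)
    (T : measurableType disp) (T' : measurableType disp') (n1 n2 : nat)
    (X : 'I_(n1 + n2) -> {mfun T >-> T'}) (w : T) : n2.-tuple T' :=
  [tuple X (rshift n1 i) w | i < n2].

Section ChanceConstraint.
Variables (R : realType) (d m l : nat).
Variables (f : 'rV[R]_d -> R) (g : 'rV[R]_d -> 'Rvec[R]_m -> 'rV[R]_l.+1).
Variables (b k : 'rV[R]_l.+1).

(* There are l.+1 >= 1 constraints, so the maximum is over a nonempty set; the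
   default value of the big operator is one of the terms. *)
Definition scaled_max (x0 : 'rV[R]_d) (xi : 'Rvec[R]_m) : R :=
  let h := fun j : 'I_l.+1 => (g x0 xi 0 j - b 0 j) / k 0 j in
  \big[Num.max/h ord0]_(j < l.+1) h j.

Definition scaled_quantile (P : probability 'Rvec[R]_m R) (eps : R)
    (x0 : 'rV[R]_d) : R :=
  quantile P (1 - eps) (scaled_max x0).

Definition ro_feasible (x0 : 'rV[R]_d) (rho : R) : set 'rV[R]_d :=
  [set x | forall xi : 'Rvec[R]_m,
     vle (g x0 xi) (b + rho *: k) -> vle (g x xi) b].

Definition ro_optimal (x0 : 'rV[R]_d) (rho : R) (x : 'rV[R]_d) : Prop :=
  ro_feasible x0 rho x /\ forall y, ro_feasible x0 rho y -> f x <= f y.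

Definition ccp_feasible (P : probability 'Rvec[R]_m R) (eps : R) :
    set 'rV[R]_d :=
  [set x | ((1 - eps)%:E <= P [set xi | vle (g x xi) b])%E].

End ChanceConstraint.

(* [q] and [rho] are functions of the realized data.  The inner probability
   redraws the Phase 2 data with the Phase 1 data [D1 w] frozen; as [D1] and
   [D2] are independent in the intended use, it is the conditional probability
   of [q <= rho] given [D1], hence the almost-sure quantifier. *)
Definition phase2_upper_bound (R : realType) (disp : measure_display)
    (T : measurableType disp) (Pr : probability T R) (S1 S2 : Type)
    (D1 : T -> S1) (D2 : T -> S2) (delta : R)
    (q : S1 -> R) (rho : S1 -> S2 -> R) : Prop :=
  {ae Pr, forall w,
    ((1 - delta)%:E <=
       Pr [set w' | (q (D1 w) <= rho (D1 w) (D2 w'))%R])%E}.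

Definition feasible_with_confidence (R : realType) (disp : measure_display)
    (T : measurableType disp) (Pr : probability T R) (S1 S2 V : Type)
    (D1 : T -> S1) (D2 : T -> S2) (delta : R)
    (F : set V) (xhat : S1 -> S2 -> V) : Prop :=
  ((1 - delta)%:E <= Pr [set w | F (xhat (D1 w) (D2 w))])%E.

(* Main.v *)
Require Import Defs.
From HB Require Import structures.
From mathcomp Require Import all_boot all_order all_algebra.
From mathcomp Require Import all_classical all_reals all_analysis.
From mathcomp Require Import measurable_realfun.

Set Implicit Arguments.
Unset Strict Implicit.
Unset Printing Implicit Defensive.

Import Order.TTheory GRing.Theory Num.Theory.
Import numFieldNormedType.Exports.

Local Open Scope classical_set_scope.
Local Open Scope ring_scope.

(** Why the theorem is true.  For a fixed realization of the data, suppose that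
    [rho] is at least the quantile [q].  The quantile is attained, so the event
    that the scaled maximum at [xhat0] is at most [q] has probability at least
    [1 - eps] ([quantile_attained]).  As the entries of [k] are positive, the
    sublevel set of the scaled maximum at level [rho] is exactly the
    uncertainty set of the robust problem ([scaled_max_leP]), on which every
    robustly feasible point, in particular [xhat], satisfies the constraints.
    Hence [xhat] is feasible for the chance constraint ([ro_feasible_ccp]), and
    it remains to bound from below the probability of [q <= rho] over the whole
    data.

    The hypothesis on [rho] bounds this probability when the Phase 2 data are
    redrawn with the Phase 1 data frozen.  Freezing is harmless because the two
    phases are independent: mutual independence of the observations gives the
    product rule for boxes, and a pi-lambda argument, once per phase, extends
    it to all measurable events ([independent_phases]).  The joint law of the
    phases is then the product of their laws, so the probability of a joint
    event is the average of its frozen probabilities, and a lower bound valid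
    for almost every frozen value survives averaging
    ([probability_independent_pair_ge]).

    When [rho <= 0], the uncertainty set lies inside the set where [xhat0]
    satisfies the constraints; then [xhat0] itself is robustly feasible, and
    the optimality of [xhat] compares the objective values. *)

(** * Quantiles *)

(** The infimum that defines a quantile is a minimum.  Were the distribution
    function below [p] at the quantile, right continuity would keep it below
    [p] a little further to the right, where a point of the set must lie.  The
    bounds on [p] and the limits of the distribution function at infinity make
    the set nonempty and bounded below, so that its infimum is a genuine one. *)
Lemma quantile_attained (R : realType) (disp : measure_display)
    (T : measurableType disp) (P : probability T R) (p : R)
    (Y : {RV P >-> R}) (hp : 0 < p < 1) :
  (p%:E <= P [set t | (Y t <= quantile P p Y)%R])%E.
Proof.
have [p0 p1] := andP hp.
have FE y : P [set t | (Y t <= y)%R] = cdf Y y.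
  by rewrite /cdf /distribution /pushforward; congr (P _).
rewrite FE leNgt; apply/negP => Fq.
pose S := [set y : R | (p%:E <= P [set t | (Y t <= y)%R])%E].
have nbhs_gtp (u : \bar R) : (p%:E < u)%E -> nbhs u [set v | (p%:E < v)%E].
  by move=> pu; apply: open_nbhs_nbhs; split => //; exact: open_ereal_gt_ereal.
have nbhs_ltp (u : \bar R) : (u < p%:E)%E -> nbhs u [set v | (v < p%:E)%E].
  by move=> up; apply: open_nbhs_nbhs; split => //; exact: open_ereal_lt_ereal.
have S0 : S !=set0.
  have [M [_ MF]] := @cvg_cdfy1 _ _ _ _ Y _ (nbhs_gtp 1%E p1).
  by exists (M + 1); rewrite /S/= FE ltW//; apply: MF; rewrite /= ltrDl.
have lbS : has_lbound S.
  have [M [_ MF]] := @cvg_cdfNy0 _ _ _ _ Y _ (nbhs_ltp 0%E p0).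
  exists M => y; rewrite /S/= FE leNgt => yS.
  by rewrite leNgt; apply: contra yS => /MF.
have [e /= e0 eF] := @cdf_right_continuous _ _ _ _ Y _ _ (nbhs_ltp _ Fq).
have [y yS ye] := inf_adherent e0 (conj S0 lbS).
suff yp : (cdf Y y < p%:E)%E by move: yS; rewrite /S/= FE leNgt yp.
have := ge_inf lbS yS; rewrite le_eqVlt => /orP[/eqP qy|qy].
  by rewrite -qy.
by apply: eF => //=; rewrite ltr0_norm ?subr_lt0// opprB ltrBlDl.
Qed.

(** * The scaled maximum *)

(** Clearing the positive denominators turns a sublevel set of the scaled
    maximum into the uncertainty set of the robust problem. *)
Lemma scaled_max_leP (R : realType) (d m l : nat)
    (g : 'rV[R]_d -> 'Rvec[R]_m -> 'rV[R]_l.+1) (b k : 'rV[R]_l.+1)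
    (hk : forall j, 0 < k 0 j) (x0 : 'rV[R]_d) (xi : 'Rvec[R]_m) (r : R) :
  scaled_max g b k x0 xi <= r <-> vle (g x0 xi) (b + r *: k).
Proof.
have hj j : ((g x0 xi 0 j - b 0 j) / k 0 j <= r) =
            (g x0 xi 0 j <= (b + r *: k) 0 j).
  by rewrite ler_pdivrMr// lerBlDl !mxE.
rewrite /scaled_max; split => [/bigmax_leP[_ h] j|h].
  by rewrite -hj h.
by apply/bigmax_leP; split => [|j _]; rewrite hj.
Qed.

Lemma measurable_vle (R : realType) (disp : measure_display)
    (T : measurableType disp) (n : nat) (u : T -> 'rV[R]_n) (v : 'rV[R]_n)
    (hu : forall j,
       measurable_fun [set: T] (fun t => u t 0 j : measurableTypeR R)) :
  measurable [set t | vle (u t) v].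
Proof.
rewrite [X in measurable X](_ : _ = \bigcap_(j in [set: 'I_n])
    ((fun t => u t 0 j : measurableTypeR R) @^-1` `]-oo, v 0 j])); last first.
  apply/seteqP; split => t /= h j; last by have := h j I; rewrite /= in_itv.
  by move=> _ /=; rewrite in_itv/=.
apply: fin_bigcap_measurable => [|j _]; first exact: finite_finset.
by rewrite -[X in measurable X]setTI; exact: hu.
Qed.

Lemma measurable_scaled_max (R : realType) (d m l : nat)
    (g : 'rV[R]_d -> 'Rvec[R]_m -> 'rV[R]_l.+1) (b k : 'rV[R]_l.+1)
    (hg : forall x j, measurable_fun [set: 'Rvec[R]_m]
            (fun xi => g x xi 0 j : measurableTypeR R)) (x0 : 'rV[R]_d) :
  measurable_fun [set: 'Rvec[R]_m] (scaled_max g b k x0).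
Proof.
rewrite /scaled_max; set h := fun j xi => (g x0 xi 0 j - b 0 j) / k 0 j.
have mh j : measurable_fun [set: 'Rvec[R]_m] (h j).
  by apply: measurable_funM => //; apply: measurable_funB => //; exact: hg.
elim: (index_enum _) => [|i s IH].
  under eq_fun do rewrite big_nil; exact: (mh ord0).
under eq_fun do rewrite big_cons; exact: measurable_maxr (mh i) IH.
Qed.

(** * Independence of the two phases *)

Definition boxes (disp : measure_display) (T : measurableType disp) (n : nat) :
    set (set (n.-tuple T)) :=
  [set A | exists2 B : 'I_n -> set T, (forall i, measurable (B i)) &
     A = [set t | forall i, B i (tnth t i)]].

Lemma boxes_setI_closed (disp : measure_display) (T : measurableType disp)
  (n : nat) : setI_closed (@boxes _ T n).
Proof.
move=> _ _ [B mB ->] [C mC ->]; exists (fun i => B i `&` C i).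
  by move=> i; exact: measurableI.
by apply/seteqP; split => t /= => [[tB tC] i//|t_]; split => i; have [] := t_ i.
Qed.

Lemma measurable_boxes (disp : measure_display) (T : measurableType disp)
  (n : nat) : @boxes _ T n `<=` measurable.
Proof.
move=> _ [B mB ->].
rewrite [X in measurable X](_ : _ = \bigcap_(i in [set: 'I_n])
    ((fun t : n.-tuple T => tnth t i) @^-1` B i)); last first.
  by apply/seteqP; split => t /= h i; have := h i => //; exact.
apply: fin_bigcap_measurable => [|i _]; first exact: finite_finset.
by rewrite -[X in measurable X]setTI; exact: measurable_tnth.
Qed.

Lemma boxes_generate (disp : measure_display) (T : measurableType disp)
  (n : nat) : @measurable _ (n.-tuple T) = <<s @boxes _ T n >>.
Proof.
apply/seteqP; split; last first.
  apply: smallest_sub; last exact: measurable_boxes.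
  exact: sigma_algebra_measurable.
apply: smallest_sub; first exact: smallest_sigma_algebra.
rewrite -bigcup_seq => A [i _ [B mB <-]]; apply: sub_sigma_algebra.
exists (fun j => if j == i then B else setT) => [j|]; first by case: ifP.
rewrite setTI; apply/seteqP; split => t /= => [tB j|/(_ i)].
  by case: eqP => // ->.
by rewrite eqxx.
Qed.

(** For a fixed event [E], the sets [A] that obey the product rule form a
    lambda-system; one that contains a generating pi-system contains every
    measurable set. *)
Lemma independent_of_generator (R : realType) (disp disp' : measure_display)
    (T : measurableType disp) (S : measurableType disp')
    (Pr : probability T R) (G : set (set S)) (D : {mfun T >-> S}) (E : set T)
    (mG : @measurable _ S = <<s G >>) (GI : setI_closed G) (mE : measurable E)
    (GE : forall A, G A -> Pr (D @^-1` A `&` E) = (Pr (D @^-1` A) * Pr E)%E)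
    (A : set S) (mA : measurable A) :
  Pr (D @^-1` A `&` E) = (Pr (D @^-1` A) * Pr E)%E.
Proof.
have mDA B : measurable B -> measurable (D @^-1` B).
  by move=> mB; exact: measurable_funPTI.
(* The factor [Pr E] is a real number, hence can be moved out of a series. *)
have PEr : Pr E = (fine (Pr E))%:E by rewrite fineK ?fin_num_measure.
rewrite muleC; move: (A) mA; rewrite {1}mG.
apply: (dynkin_induction mG GI) => //.
- by rewrite preimage_setT setTI probability_setT mule1.
- by move=> B GB; rewrite GE// muleC.
- move=> B mB BE; have mB' := mDA _ mB.
  rewrite -[D @^-1` (~` B)]/(~` (D @^-1` B)) setIC -setDE.
  rewrite measureD//; last first.
    by rewrite (le_lt_trans (probability_le1 _ _)) ?ltry.
  rewrite [X in (_ - Pr X)%E]setIC [X in (_ - X)%E]BE probability_setC//.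
  by rewrite muleBr ?mule1 ?fin_num_measure// fin_num_adde_defr.
- move=> F mF tF FE; rewrite preimage_bigcup setI_bigcupl.
  have tDF : trivIset setT (fun n => D @^-1` F n).
    apply/trivIsetP => i j _ _ ij; rewrite -preimage_setI.
    by move/trivIsetP : tF => ->//; rewrite preimage_set0.
  rewrite !measure_bigcup//.
  + rewrite PEr -nneseriesZl//; apply: eq_eseriesr => n _.
    by rewrite -PEr; exact: FE.
  + by move=> n _; exact: mDA.
  + by move=> n _; apply: measurableI => //; exact: mDA.
  + exact: trivIset_setIr.
Qed.

Lemma measurable_phase1 (disp disp' : measure_display)
    (T : measurableType disp) (T' : measurableType disp') (n1 n2 : nat)
    (X : 'I_(n1 + n2) -> {mfun T >-> T'}) :
  measurable_fun [set: T] (phase1 X).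
Proof.
apply/measurable_fun_tnthP => i.
apply: eq_measurable_fun (measurable_funPT (X (lshift n2 i))).
by move=> w _ /=; rewrite tnth_mktuple.
Qed.

Lemma measurable_phase2 (disp disp' : measure_display)
    (T : measurableType disp) (T' : measurableType disp') (n1 n2 : nat)
    (X : 'I_(n1 + n2) -> {mfun T >-> T'}) :
  measurable_fun [set: T] (phase2 X).
Proof.
apply/measurable_fun_tnthP => i.
apply: eq_measurable_fun (measurable_funPT (X (rshift n1 i))).
by move=> w _ /=; rewrite tnth_mktuple.
Qed.

HB.instance Definition _ (disp disp' : measure_display)
    (T : measurableType disp) (T' : measurableType disp') (n1 n2 : nat)
    (X : 'I_(n1 + n2) -> {mfun T >-> T'}) :=
  isMeasurableFun.Build _ _ _ _ (phase1 X) (measurable_phase1 X).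

HB.instance Definition _ (disp disp' : measure_display)
    (T : measurableType disp) (T' : measurableType disp') (n1 n2 : nat)
    (X : 'I_(n1 + n2) -> {mfun T >-> T'}) :=
  isMeasurableFun.Build _ _ _ _ (phase2 X) (measurable_phase2 X).

(** A pair of boxes, one per phase, is a single box over all the observations,
    to which mutual independence applies with the full index set. *)
Lemma phases_boxes (R : realType) (disp disp' : measure_display)
    (T : measurableType disp) (T' : measurableType disp') (n1 n2 : nat)
    (Pr : probability T R) (X : 'I_(n1 + n2) -> {mfun T >-> T'})
    (hX : mutually_independent Pr X) (B : 'I_n1 -> set T') (C : 'I_n2 -> set T')
    (mB : forall i, measurable (B i)) (mC : forall i, measurable (C i)) :
  Pr (phase1 X @^-1` [set t | forall i, B i (tnth t i)] `&`
      phase2 X @^-1` [set t | forall i, C i (tnth t i)]) =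
  ((\prod_(i < n1) Pr (X (lshift n2 i) @^-1` B i)) *
   (\prod_(i < n2) Pr (X (rshift n1 i) @^-1` C i)))%E.
Proof.
pose A (i : 'I_(n1 + n2)) :=
  match fintype.split i with inl j => B j | inr j => C j end.
have Al j : A (lshift n2 j) = B j by rewrite /A (unsplitK (inl j)).
have Ar j : A (rshift n1 j) = C j by rewrite /A (unsplitK (inr j)).
have mA i : measurable (A i) by rewrite /A; case: fintype.split.
have := hX (finset.setTfor 'I_(n1 + n2)) A mA.
under eq_bigl do rewrite finset.in_setT.
rewrite big_split_ord /=.
under eq_bigr do rewrite Al; under [X in (_ * X)%E]eq_bigr do rewrite Ar.
move=> <-; congr (Pr _); apply/seteqP; split => w /=.
  move=> [hB hC] i _ /=.
  rewrite -(fintype.splitK i); case: (fintype.split i) => j /=.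
    by rewrite Al; have := hB j; rewrite tnth_mktuple.
  by rewrite Ar; have := hC j; rewrite tnth_mktuple.
move=> h; split => j; rewrite tnth_mktuple.
  by rewrite -Al; apply: h => /=; rewrite finset.in_setT.
by rewrite -Ar; apply: h => /=; rewrite finset.in_setT.
Qed.

(** The marginal probabilities of boxes are the case of [phases_boxes] in which
    the other box is the whole space.  The product rule is extended to arbitrary
    measurable sets in one phase at a time, the event of the other phase being
    kept fixed: [B] is arbitrary but fixed while [A] is reduced to a box, which
    is then fixed while [B] is reduced to a box. *)
Lemma independent_phases (R : realType) (disp disp' : measure_display)
    (T : measurableType disp) (T' : measurableType disp') (n1 n2 : nat)
    (Pr : probability T R) (X : 'I_(n1 + n2) -> {mfun T >-> T'})
    (hX : mutually_independent Pr X)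
    (A : set (n1.-tuple T')) (B : set (n2.-tuple T'))
    (mA : measurable A) (mB : measurable B) :
  Pr (phase1 X @^-1` A `&` phase2 X @^-1` B) =
  (Pr (phase1 X @^-1` A) * Pr (phase2 X @^-1` B))%E.
Proof.
have boxT n : [set t : n.-tuple T' | forall i, [set: T'] (tnth t i)] = setT.
  by apply/seteqP; split.
have marginal1 C : (forall i, measurable (C i)) ->
    Pr (phase1 X @^-1` [set t | forall i, C i (tnth t i)]) =
    (\prod_(i < n1) Pr (X (lshift n2 i) @^-1` C i))%E.
  move=> mC; have := phases_boxes hX mC (fun=> @measurableT _ T').
  rewrite boxT preimage_setT setIT => ->.
  rewrite [X in (_ * X)%E]big1 ?mule1// => i _.
  by rewrite preimage_setT probability_setT.
have marginal2 D : (forall i, measurable (D i)) ->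
    Pr (phase2 X @^-1` [set t | forall i, D i (tnth t i)]) =
    (\prod_(i < n2) Pr (X (rshift n1 i) @^-1` D i))%E.
  move=> mD; have := phases_boxes hX (fun=> @measurableT _ T') mD.
  rewrite boxT preimage_setT setTI => ->.
  rewrite [X in (X * _)%E]big1 ?mul1e// => i _.
  by rewrite preimage_setT probability_setT.
apply: (independent_of_generator (@boxes_generate _ T' n1)) => //.
- exact: boxes_setI_closed.
- exact: measurable_funPTI.
move=> _ [C mC ->]; rewrite setIC muleC.
apply: (independent_of_generator (@boxes_generate _ T' n2)) => //.
- exact: boxes_setI_closed.
- by apply: measurable_funPTI; apply: measurable_boxes; exists C.
move=> _ [D mD ->]; rewrite setIC phases_boxes// muleC; congr (_ * _)%E.
  by apply/esym; exact: marginal2.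
by apply/esym; exact: marginal1.
Qed.

(** * Freezing one of two independent variables *)

(** The joint law of independent variables is the product of their laws;
    integrating over the first factor the measures of the sections of [A] gives
    the formula. *)
Lemma probability_independent_pair (R : realType) (disp d1 d2 : measure_display)
    (T : measurableType disp) (S1 : measurableType d1) (S2 : measurableType d2)
    (Pr : probability T R) (D1 : {mfun T >-> S1}) (D2 : {mfun T >-> S2})
    (D12 : forall A B, measurable A -> measurable B ->
       Pr (D1 @^-1` A `&` D2 @^-1` B) =
       (Pr (D1 @^-1` A) * Pr (D2 @^-1` B))%E)
    (A : set (S1 * S2)) (mA : measurable A) :
  Pr [set w | A (D1 w, D2 w)] =
  (\int[Pr]_w Pr [set w' | A (D1 w, D2 w')])%E.
Proof.
have mD : measurable_fun [set: T] (fun w => (D1 w, D2 w)).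
  exact: measurable_fun_pair.
pose X : {mfun T >-> (S1 * S2)%type} :=
  HB.pack (fun w => (D1 w, D2 w)) (isMeasurableFun.Build _ _ _ _ _ mD).
transitivity ((distribution Pr D1 \x distribution Pr D2)%E A).
  by rewrite (product_measure_unique (m' := distribution Pr X)).
rewrite /product_measure1 ge0_integral_pushforward//=; last first.
  exact: measurable_fun_xsection.
rewrite preimage_setT; apply: eq_integral => w _ /=.
rewrite /distribution /pushforward; congr (Pr _).
by apply/seteqP; split => w' /=; rewrite /xsection /= inE.
Qed.

(** This is how a guarantee conditional on [D1] becomes an unconditional one. *)
Lemma probability_independent_pair_ge (R : realType)
    (disp d1 d2 : measure_display) (T : measurableType disp)
    (S1 : measurableType d1) (S2 : measurableType d2) (Pr : probability T R)
    (D1 : {mfun T >-> S1}) (D2 : {mfun T >-> S2}) (c : R)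
    (c0 : 0 <= c)
    (D12 : forall A B, measurable A -> measurable B ->
       Pr (D1 @^-1` A `&` D2 @^-1` B) =
       (Pr (D1 @^-1` A) * Pr (D2 @^-1` B))%E)
    (A : set (S1 * S2)) (mA : measurable A)
    (hA : {ae Pr, forall w, (c%:E <= Pr [set w' | A (D1 w, D2 w')])%E}) :
  (c%:E <= Pr [set w | A (D1 w, D2 w)])%E.
Proof.
rewrite probability_independent_pair//.
rewrite -[leLHS]mule1 -(probability_setT Pr) -integral_cst//.
apply: ae_ge0_le_integral => //.
  rewrite [X in measurable_fun _ X](_ : _ =
    (distribution Pr D2 \o xsection A) \o D1).
    apply: measurableT_comp (measurable_funPT D1).
    exact: (measurable_fun_xsection (distribution Pr D2) mA).
  apply/funext => w /=; rewrite /distribution /pushforward; congr (Pr _).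
  by apply/seteqP; split => w' /=; rewrite /xsection /= inE.
by apply: filterS hA => w h _.
Qed.

(** * From the robust problem to the chance constraint *)

(** The deterministic core: once [r] dominates the quantile, the uncertainty
    set of the robust problem has probability at least [1 - eps], and a robustly
    feasible point satisfies the constraints throughout that set. *)
Lemma ro_feasible_ccp (R : realType) (d m l : nat) (eps : R)
    (heps : 0 < eps < 1)
    (g : 'rV[R]_d -> 'Rvec[R]_m -> 'rV[R]_l.+1)
    (b k : 'rV[R]_l.+1) (hk : forall j, 0 < k 0 j)
    (hg : forall x j, measurable_fun [set: 'Rvec[R]_m]
            (fun xi => g x xi 0 j : measurableTypeR R))
    (P : probability 'Rvec[R]_m R) (x0 x : 'rV[R]_d) (r : R) :
  scaled_quantile g b k P eps x0 <= r -> ro_feasible g b k x0 r x ->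
  ccp_feasible g b P eps x.
Proof.
move=> qr xF; rewrite /ccp_feasible /=.
have mY := measurable_scaled_max b k hg x0.
pose Y : {RV P >-> R} := HB.pack (scaled_max g b k x0)
  (isMeasurableFun.Build _ _ _ _ _ mY).
have p01 : 0 < 1 - eps < 1.
  by case/andP: heps => e0 e1; rewrite subr_gt0 e1 gtrBl.
apply: le_trans (quantile_attained Y p01) _.
apply: le_measure; rewrite ?inE.
- rewrite [X in measurable X](_ : _ = Y @^-1` `]-oo, quantile P (1 - eps) Y]).
    exact: measurable_funPTI.
  by apply/seteqP; split => xi /=; rewrite in_itv.
- exact: measurable_vle.
- move=> xi /= Yq; apply: xF; apply/(scaled_max_leP g b hk x0).
  exact: le_trans Yq qr.
Qed.

Theorem corollary2 (R : realType) (d m l n1 n2 : nat) (eps delta : R)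
  (heps : 0 < eps < 1) (hdelta : 0 < delta < 1)
  (f : 'rV[R]_d -> R) (g : 'rV[R]_d -> 'Rvec[R]_m -> 'rV[R]_l.+1)
  (b k : 'rV[R]_l.+1) (hk : forall j, 0 < k 0 j)
  (hg : forall x j, measurable_fun [set: 'Rvec[R]_m]
          (fun xi => g x xi 0 j : measurableTypeR R))
  (P : probability 'Rvec[R]_m R)
  (disp : measure_display) (T : measurableType disp) (Pr : probability T R)
  (X : 'I_(n1 + n2) -> {mfun T >-> 'Rvec[R]_m}) (hX : iid_sample Pr P X)
  (xhat0 : n1.-tuple 'Rvec[R]_m -> 'rV[R]_d)
  (rho : n1.-tuple 'Rvec[R]_m -> n2.-tuple 'Rvec[R]_m -> R)
  (xhat : n1.-tuple 'Rvec[R]_m -> n2.-tuple 'Rvec[R]_m -> 'rV[R]_d)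
  (mrho : measurable [set D : n1.-tuple 'Rvec[R]_m * n2.-tuple 'Rvec[R]_m |
            scaled_quantile g b k P eps (xhat0 D.1) <= rho D.1 D.2])
  (mxhat : measurable [set D : n1.-tuple 'Rvec[R]_m * n2.-tuple 'Rvec[R]_m |
            ccp_feasible g b P eps (xhat D.1 D.2)])
  (hrho : phase2_upper_bound Pr (phase1 X) (phase2 X) delta
            (fun D1 => scaled_quantile g b k P eps (xhat0 D1)) rho)
  (hxhat : forall D1 D2, ro_optimal f g b k (xhat0 D1) (rho D1 D2)
                           (xhat D1 D2)) :
  feasible_with_confidence Pr (phase1 X) (phase2 X) delta
    (ccp_feasible g b P eps) xhat /\
  (forall D1 D2, rho D1 D2 <= 0 -> f (xhat D1 D2) <= f (xhat0 D1)).
Proof.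
split; last first.
  move=> D1 D2 r0; apply: (hxhat D1 D2).2 => xi gxi j.
  apply: le_trans (gxi j) _.
  by rewrite !mxE gerDl mulr_le0_ge0// ltW.
have c0 : 0 <= 1 - delta by case/andP: hdelta => _ /ltW; rewrite subr_ge0.
have [indepX _] := hX.
have measurable_pair S : measurable S ->
    measurable [set w | S (phase1 X w, phase2 X w)].
  by move=> mS; rewrite -[X in measurable X]setTI; apply: measurable_fun_pair.
(* It suffices to bound the probability of the event [quantile <= rho], which
   implies feasibility. *)
have := probability_independent_pair_ge c0 (independent_phases indepX)
  mrho hrho.
move=> /le_trans; apply; apply: le_measure; rewrite ?inE.
- exact: measurable_pair mrho.
- exact: measurable_pair mxhat.
- move=> w /= qr; exact: (ro_feasible_ccp heps hk hg qr (hxhat _ _).1).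
Qed.
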